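(* Let $q$ be a complex number with $|q|>1$, and let $a,b,c,d$ be parameters such that $\left| \frac{q^{a+b+1}}{q^{c+d}} \right| < 1$ (and such that no denominator below vanishes). Let \begin{multline*} p(n) = q^{n (a-b-1)} \big(-q^{a+b+c+d+3 n}-q^{a+b+c+d+3 n+1}+q^{a+b+c+2 d+5 n}-q^{a+b+2 d+4 n+1}+q^{2 a+b+1}+q^{a+c+2 d+4 n+1}\\-q^{2 a+d+n+1}+q^{a+2 d+3 n+1}+q^{b+c+2 d+5 n+1}-q^{c+2 d+4 n+1}+q^{2 c+2 d+5 n}-q^{2 c+3 d+7 n}\big). \end{multline*} Then \begin{multline*} (1-q^d) (q^{c+d} - q^{a+b}) (q^{c+d} - q^{a+b+1})\, {}_{3}\phi_{2}\!\left[ \begin{matrix} q^{a}, q^{b}, q \\ q^{c}, q^{d} \end{matrix} \ \Big| \ q; q \right] \\ = \sum_{n=0}^{\infty} (-1)^{n} q^{-\binom{n}{2}}\, \frac{(q^{d-a};q^2)_n\,(q^{d-a+1};q^2)_n}{(q^{d+1};q^2)_n\,(q^{d+2};q^2)_n\,(q^{c+d-a-b+1};q^2)_n\,(q^{c+d-a-b+2};q^2)_n}\cdot\frac{(q^{b};q)_n\,(q^{c-a};q)_n\,(q^{d-b};q)_n}{(q^{c};q)_n}\, p(n). \end{multline*}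
   Context: For complex $x$ and $Q$, and integer $n\ge 0$, the $q$-shifted factorial is $(x;Q)_0=1$ and $(x;Q)_n=(1-x)(1-xQ)\cdots(1-xQ^{n-1})$ for $n\ge1$. Powers $q^{x}$ with non-integer exponent are taken as $e^{x\log q}$ for a fixed choice of $\log q$. The basic hypergeometric series is \[ {}_{3}\phi_{2}\!\left[ \begin{matrix} a_1,a_2,a_3 \\ b_1,b_2 \end{matrix} \ \Big| \ q; z \right]=\sum_{n=0}^{\infty}\frac{(a_1;q)_n(a_2;q)_n(a_3;q)_n}{(q;q)_n(b_1;q)_n(b_2;q)_n}\,z^n . \] *)

(* Defs.v *)
From Stdlib Require Import Reals Lra.
From Coquelicot Require Import Coquelicot.
Open Scope C_scope.

Definition Cexp (z : C) : C :=
  (exp (Re z) * cos (Im z), exp (Re z) * sin (Im z))%R.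

(* [lq] is the chosen value of log q, i.e. any complex number with
   [Cexp lq = q]; [qpow lq x] is then q^x. *)
Definition qpow (lq x : C) : C := Cexp (x * lq).

Definition nC (n : nat) : C := RtoC (INR n).

(* (x; Q)_n *)
Fixpoint qpoch (x Q : C) (n : nat) : C :=
  match n with
  | O => 1
  | S m => qpoch x Q m * (1 - x * Q ^ m)
  end.

(* Coquelicot's [Series] is real-valued. The value below is only meaningful
   when the series converges, see [CSeries_unique]. *)
Definition CSeries (u : nat -> C) : C :=
  (Series (fun n => Re (u n)), Series (fun n => Im (u n))).

Lemma CSeries_unique (u : nat -> C) (s : C) : is_series u s -> CSeries u = s.
Proof.
intros H.
assert (HR : forall n, Re (sum_n u n) = sum_n (fun k => Re (u k)) n).
{ induction n as [|n IH]; [now rewrite !sum_O|].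
  rewrite !sum_Sn, <- IH. reflexivity. }
assert (HI : forall n, Im (sum_n u n) = sum_n (fun k => Im (u k)) n).
{ induction n as [|n IH]; [now rewrite !sum_O|].
  rewrite !sum_Sn, <- IH. reflexivity. }
assert (Hle : forall x y : C, (Rabs (Re x - Re y) <= Cmod (x - y))%R /\
                              (Rabs (Im x - Im y) <= Cmod (x - y))%R).
{ intros x y. pose proof (Rmax_Cmod (x - y)) as B. simpl in B.
  split; (eapply Rle_trans; [|exact B]);
    [apply Rmax_l | apply Rmax_r]. }
assert (Hlim : forall eps : posreal,
          eventually (fun n => (Cmod (sum_n u n - s) < eps)%R)).
{ intros eps. apply (H (fun y => (Cmod (y - s) < eps)%R)).
  apply (locally_le_locally_norm (V := C_NormedModule) s).
  exists eps. intros y Hy. exact Hy. }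
unfold CSeries. rewrite (surjective_pairing s). f_equal.
- apply is_series_unique.
  refine (proj1 (is_lim_seq_spec _ (Finite _)) _). intros eps.
  destruct (Hlim eps) as [N HN]. exists N. intros n Hn.
  rewrite <- HR. eapply Rle_lt_trans; [apply (Hle (sum_n u n) s)|now apply HN].
- apply is_series_unique.
  refine (proj1 (is_lim_seq_spec _ (Finite _)) _). intros eps.
  destruct (Hlim eps) as [N HN]. exists N. intros n Hn.
  rewrite <- HI. eapply Rle_lt_trans; [apply (Hle (sum_n u n) s)|now apply HN].
Qed.

Definition phi32_den (b1 b2 q : C) (n : nat) : C :=
  qpoch q q n * qpoch b1 q n * qpoch b2 q n.

Definition phi32_term (a1 a2 a3 b1 b2 q z : C) (n : nat) : C :=
  qpoch a1 q n * qpoch a2 q n * qpoch a3 q n / phi32_den b1 b2 q n * z ^ n.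

Definition phi32 (a1 a2 a3 b1 b2 q z : C) : C :=
  CSeries (phi32_term a1 a2 a3 b1 b2 q z).

Definition p (lq a b c d : C) (k : nat) : C :=
  let P := qpow lq in
  let n := nC k in
  P (n * (a - b - 1)) *
  (- P (a + b + c + d + 3 * n)
   - P (a + b + c + d + 3 * n + 1)
   + P (a + b + c + 2 * d + 5 * n)
   - P (a + b + 2 * d + 4 * n + 1)
   + P (2 * a + b + 1)
   + P (a + c + 2 * d + 4 * n + 1)
   - P (2 * a + d + n + 1)
   + P (a + 2 * d + 3 * n + 1)
   + P (b + c + 2 * d + 5 * n + 1)
   - P (c + 2 * d + 4 * n + 1)
   + P (2 * c + 2 * d + 5 * n)
   - P (2 * c + 3 * d + 7 * n)).

(* Denominator of the first quotient of the n-th term of the accelerated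
   series. *)
Definition accel_den (lq q a b c d : C) (n : nat) : C :=
  qpoch (qpow lq (d + 1)) (q ^ 2) n *
  qpoch (qpow lq (d + 2)) (q ^ 2) n *
  qpoch (qpow lq (c + d - a - b + 1)) (q ^ 2) n *
  qpoch (qpow lq (c + d - a - b + 2)) (q ^ 2) n.

(* The binomial coefficient (n choose 2) is written n (n - 1) / 2. *)
Definition accel_term (lq q a b c d : C) (n : nat) : C :=
  (- (1)) ^ n * qpow lq (- (nC n * (nC n - 1) / 2)) *
  (qpoch (qpow lq (d - a)) (q ^ 2) n *
   qpoch (qpow lq (d - a + 1)) (q ^ 2) n / accel_den lq q a b c d n) *
  (qpoch (qpow lq b) q n * qpoch (qpow lq (c - a)) q n *
   qpoch (qpow lq (d - b)) q n / qpoch (qpow lq c) q n) *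
  p lq a b c d n.

(* Main.v *)
(** Write A = q^a, B = q^b, U = q^c, V = q^d, and let S(A,B,U,V) be the 3phi2
    series. A rational certificate of Gosper-Zeilberger type yields a first
    order contiguous relation
      W S(A,B,U,V) = P + K S(A, Bq, Uq, Vq^2),
    with W = (1-V)(UV-AB)(UV-ABq) and P the value of the bracket in p(0).
    Iterating it gives the accelerated series: its n-th term is P at
    (A, Bq^n, Uq^n, Vq^(2n)) times the accumulated product of the quotients of
    K by the next W. The remainder tends to 0 since K/W = O(q^(-3n)) along the
    iteration while the shifted sums S stay bounded by 2. *)

Require Import Defs.
From Stdlib Require Import Reals ZArith Lra Lia.
From Coquelicot Require Import Coquelicot.
Open Scope C_scope.

(** * Shifted factorials *)

Lemma qpoch_shift (x q : C) (n : nat) :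
  (1 - x) * qpoch (x * q) q n = qpoch x q n * (1 - x * q ^ n).
Proof.
induction n as [|n IH]; simpl; [ring|].
rewrite Cmult_assoc, IH; ring.
Qed.

Lemma qpoch_neq_0 (x q : C) (n : nat) :
  (forall k, 1 - x * q ^ k <> 0) -> qpoch x q n <> 0.
Proof.
intros Hx; induction n as [|n IH]; simpl; [apply C1_nz|].
now apply Cmult_neq_0.
Qed.

Lemma qpoch_factor_neq_0 (x q : C) (n : nat) :
  qpoch x q (S n) <> 0 -> 1 - x * q ^ n <> 0.
Proof.
intros H H0; apply H; simpl; rewrite H0; ring.
Qed.

(** * The terms of the series and the telescoping certificate *)

(** The term of the 3phi2 series with third upper parameter q and argument q: there (q;q)_k cancels
    between numerator and denominator. *)
Definition phi_term (A B U V q : C) (k : nat) : C :=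
  qpoch A q k * qpoch B q k / (qpoch U q k * qpoch V q k) * q ^ k.

Lemma phi_term_S (A B U V q : C) (k : nat) :
  (forall j, 1 - U * q ^ j <> 0) -> (forall j, 1 - V * q ^ j <> 0) ->
  phi_term A B U V q (S k) =
  q * (1 - A * q ^ k) * (1 - B * q ^ k) /
    ((1 - U * q ^ k) * (1 - V * q ^ k)) * phi_term A B U V q k.
Proof.
intros HU HV; unfold phi_term; simpl.
field; repeat split; auto; now apply qpoch_neq_0.
Qed.

Definition weight (A B U V q : C) : C :=
  (1 - V) * (U * V - A * B) * (U * V - A * B * q).

(* With x = q^k, the certificate is (cert0/x + cert1 + cert2 x) / (1 - V x);
   this ansatz turns the telescoping identity into a cubic in x, and the
   coefficients solve the resulting linear system. *)
Definition cert0 (A B U V q : C) : C :=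
  q * (A * A * B - A * A * V + A * V * V - U * V * V).
Definition cert1 (A B U V q : C) : C :=
  V * (U * U * V - A * B * U - A * B * q * (U + V) + U * V * q * (A + B)).
Definition cert2 (A B U V : C) : C := - (U * V * V * (U * V - A * B)).

(** For V <> 1 this is (1 - V) times [cert] at k = 0, the only value that survives telescoping. *)
Definition boundary (A B U V q : C) : C :=
  cert0 A B U V q + cert1 A B U V q + cert2 A B U V.

Definition factor (A B U V q : C) : C :=
  - q * (A - V) * (A - V * q) * (A - U) * (B - V) * (1 - B) /
    ((1 - U) * (1 - V * q)).

Definition cert (A B U V q : C) (k : nat) : C :=
  (cert0 A B U V q + cert1 A B U V q * q ^ k + cert2 A B U V * (q ^ k * q ^ k))
    / (q ^ k * (1 - V * q ^ k)) * phi_term A B U V q k.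

(** The factor 1 - B stays on the left instead of being divided out, so that B = 1 is covered;
    [factor] supplies it later. *)
Lemma phi_term_shift (A B U V q : C) (k : nat) :
  (forall j, 1 - U * q ^ j <> 0) -> (forall j, 1 - V * q ^ j <> 0) ->
  (1 - B) * phi_term A (B * q) (U * q) (V * q * q) q k =
  (1 - B * q ^ k) * (1 - U) * (1 - V) * (1 - V * q) /
    ((1 - U * q ^ k) * (1 - V * q ^ k) * (1 - V * q * q ^ k)) *
    phi_term A B U V q k.
Proof.
intros HU HV.
assert (HU' : forall j, 1 - U * q * q ^ j <> 0)
  by (intros j E; apply (HU (S j)); simpl; rewrite <- E; ring).
assert (HV' : forall j, 1 - V * q * q ^ j <> 0)
  by (intros j E; apply (HV (S j)); simpl; rewrite <- E; ring).
assert (HV'' : forall j, 1 - V * q * q * q ^ j <> 0)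
  by (intros j E; apply (HV' (S j)); simpl; rewrite <- E; ring).
assert (U0 : 1 - U <> 0) by (intros E; apply (HU O); simpl; rewrite <- E; ring).
assert (V0 : 1 - V <> 0) by (intros E; apply (HV O); simpl; rewrite <- E; ring).
assert (V1 : 1 - V * q <> 0)
  by (intros E; apply (HV' O); simpl; rewrite <- E; ring).
assert (EB := qpoch_shift B q k).
assert (shiftE : forall x, 1 - x <> 0 ->
  qpoch (x * q) q k = qpoch x q k * (1 - x * q ^ k) / (1 - x))
  by (intros x x1; rewrite <- qpoch_shift; field; auto).
assert (EU := shiftE U U0).
assert (EV : qpoch (V * q * q) q k =
  qpoch V q k * (1 - V * q ^ k) * (1 - V * q * q ^ k) / ((1 - V) * (1 - V * q))).
{ rewrite !shiftE by auto; field; auto. }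
unfold phi_term; rewrite EU, EV.
transitivity (qpoch A q k * ((1 - B) * qpoch (B * q) q k) /
  (qpoch U q k * (1 - U * q ^ k) / (1 - U) *
   (qpoch V q k * (1 - V * q ^ k) * (1 - V * q * q ^ k) / ((1 - V) * (1 - V * q))))
  * q ^ k).
{ unfold Cdiv; ring. }
rewrite EB; field; repeat split; auto; now apply qpoch_neq_0.
Qed.

(** The shifted term and the next term are both rational multiples of [phi_term A B U V q k], up to
    the factor 1 - B contained in [factor]. Dividing that term out leaves an identity of rational
    functions in q^k. *)
Lemma cert_telescopes (A B U V q : C) (k : nat) :
  q <> 0 ->
  (forall j, 1 - U * q ^ j <> 0) -> (forall j, 1 - V * q ^ j <> 0) ->
  weight A B U V q * phi_term A B U V q k
  - factor A B U V q * phi_term A (B * q) (U * q) (V * q * q) q k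
  = (1 - V) * (cert A B U V q k - cert A B U V q (S k)).
Proof.
intros q0 HU HV.
assert (U0 : 1 - U <> 0) by (intros E; apply (HU O); simpl; rewrite <- E; ring).
assert (V0 : 1 - V <> 0) by (intros E; apply (HV O); simpl; rewrite <- E; ring).
assert (V1 : 1 - V * q <> 0)
  by (intros E; apply (HV 1%nat); simpl; rewrite <- E; ring).
assert (HV' : 1 - V * (q * q ^ k) <> 0) by exact (HV (S k)).
assert (HV'' : 1 - V * q * q ^ k <> 0) by (rewrite <- Cmult_assoc; auto).
assert (qk : q ^ k <> 0) by now apply Cpow_nz.
unfold factor.
transitivity (weight A B U V q * phi_term A B U V q k -
  - q * (A - V) * (A - V * q) * (A - U) * (B - V) /
  ((1 - U) * (1 - V * q)) * ((1 - B) * phi_term A (B * q) (U * q) (V * q * q) q k)).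
{ unfold Cdiv; ring. }
rewrite phi_term_shift by auto.
unfold cert; rewrite phi_term_S by auto.
generalize (HU k) (HV k); simpl.
generalize (phi_term A B U V q k); revert qk HV' HV''.
unfold weight, cert0, cert1, cert2.
generalize (q ^ k); intros x qk HV' HV'' F HUk HVk.
field; repeat split; auto.
Qed.

(** * Telescoping sums and geometric majorants of complex series *)

Lemma is_series_telescope (r : nat -> C) :
  is_lim_seq (fun n => Cmod (r n)) 0 ->
  is_series (fun n => r n - r (S n)) (r O).
Proof.
intros H.
assert (Hsum : forall n, sum_n (fun k => r k - r (S k)) n = r O - r (S n)).
{ induction n as [|n IH]; [now rewrite sum_O|].
  rewrite sum_Sn, IH. unfold plus; simpl; ring. }
apply (proj2 (filterlim_locally (U := C_UniformSpace) _ _)).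
intros eps.
destruct (proj2 (is_lim_seq_spec _ (Finite 0)) H eps) as [N HN].
exists N; intros n Hn.
apply C_NormedModule_mixin_compat1.
rewrite Hsum.
replace (minus (r O - r (S n)) (r O)) with (- r (S n))
  by (unfold minus, plus, opp; simpl; ring).
rewrite Cmod_opp.
assert (Hn' : (N <= S n)%nat) by lia.
generalize (HN (S n) Hn').
rewrite Rminus_0_r, Rabs_pos_eq by apply Cmod_ge_0; auto.
Qed.

(** Induction on the threshold [K]: dropping the first term lowers it by one. The constant is then
    divided by r for the index shift and enlarged to cover the dropped term. *)
Lemma eventually_geometric (t : nat -> C) (r : R) (K : nat) :
  (0 < r)%R ->
  (forall k, (K <= k)%nat -> (Cmod (t (S k)) <= r * Cmod (t k))%R) ->
  exists M, forall k, (Cmod (t k) <= M * r ^ k)%R.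
Proof.
intros r0; revert t; induction K as [|K IH]; intros t Ht.
- exists (Cmod (t O)); induction k as [|k IHk]; [simpl; lra|].
  eapply Rle_trans; [apply Ht; lia|]. simpl; nra.
- destruct (IH (fun k => t (S k))) as [M HM].
  { intros k Hk; apply Ht; lia. }
  exists (Rmax (Cmod (t O)) (M / r)); intros [|k].
  + simpl; rewrite Rmult_1_r; apply Rmax_l.
  + eapply Rle_trans; [apply HM|].
    replace (M * r ^ k)%R with (M / r * r ^ S k)%R by (simpl; field; lra).
    apply Rmult_le_compat_r; [apply pow_le; lra|apply Rmax_r].
Qed.

Lemma is_lim_seq_geom_scal (M r : R) :
  (0 < r < 1)%R -> is_lim_seq (fun k => M * r ^ k)%R 0.
Proof.
intros Hr.
replace (Finite 0) with (Rbar_mult M 0) by (simpl; f_equal; ring).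
apply is_lim_seq_scal_l, is_lim_seq_geom.
rewrite Rabs_pos_eq; lra.
Qed.

Lemma is_lim_seq_Cmod_0 (t : nat -> C) (v : nat -> R) :
  eventually (fun k => (Cmod (t k) <= v k)%R) -> is_lim_seq v 0 ->
  is_lim_seq (fun k => Cmod (t k)) 0.
Proof.
intros Ht Hv.
apply (is_lim_seq_le_le_loc (fun _ => 0%R) _ v).
- destruct Ht as [N HN]; exists N; intros n Hn; split; auto; apply Cmod_ge_0.
- apply is_lim_seq_const.
- exact Hv.
Qed.

Lemma geometric_is_series (t : nat -> C) (M r : R) :
  (0 < r < 1)%R -> (forall k, (Cmod (t k) <= M * r ^ k)%R) ->
  is_series t (CSeries t).
Proof.
intros Hr Ht.
destruct (ex_series_le (K := C_AbsRing) (V := C_CompleteNormedModule)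
            t (fun k => M * r ^ k)%R) as [s Hs].
- intros k; exact (Ht k).
- apply (ex_series_scal_l (K := R_AbsRing) M (fun k => r ^ k)%R).
  apply ex_series_geom; rewrite Rabs_pos_eq; lra.
- now rewrite (CSeries_unique t s Hs).
Qed.

Lemma geometric_CSeries_le (t : nat -> C) (M r : R) :
  (0 < r < 1)%R -> (forall k, (Cmod (t k) <= M * r ^ k)%R) ->
  (Cmod (CSeries t) <= M / (1 - r))%R.
Proof.
intros Hr Ht.
assert (M0 : (0 <= M)%R).
{ generalize (Ht O) (Cmod_ge_0 (t O)); simpl; lra. }
(* The exact value of the geometric partial sum is kept so that the induction closes. *)
assert (Hsum : forall n,
  (Cmod (sum_n t n) <= M / (1 - r) * (1 - r ^ S n))%R).
{ induction n as [|n IH].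
  - rewrite sum_O; eapply Rle_trans; [apply Ht|].
    right; simpl; field; lra.
  - rewrite sum_Sn; eapply Rle_trans; [apply Cmod_triangle|].
    eapply Rle_trans; [apply Rplus_le_compat; [apply IH|apply Ht]|].
    right; simpl; field; lra. }
apply (is_lim_seq_le (fun n => Cmod (sum_n t n)) (fun _ => M / (1 - r))%R
         (Finite (Cmod (CSeries t))) (Finite (M / (1 - r)))%R).
- intros n; eapply Rle_trans; [apply Hsum|].
  rewrite <- (Rmult_1_r (M / (1 - r))) at 2.
  apply Rmult_le_compat_l.
  + apply Rmult_le_pos; [exact M0|].
    apply Rlt_le, Rinv_0_lt_compat; lra.
  + assert (0 <= r ^ S n)%R by (apply pow_le; lra). lra.
- eapply filterlim_comp; [apply (geometric_is_series t M r Hr Ht)|].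
  apply (filterlim_norm (K := C_AbsRing) (V := C_NormedModule)).
- apply is_lim_seq_const.
Qed.

(** * Size of q^k, of the terms and of the certificate for |q| > 1 *)

Lemma eventually_pow_ge (q : C) (M : R) :
  (1 < Cmod q)%R -> eventually (fun k => (M <= Cmod (q ^ k))%R).
Proof.
intros Hq.
destruct (proj2 (is_lim_seq_spec _ p_infty) (is_lim_seq_geom_p _ Hq) M) as [N HN].
exists N; intros n Hn; rewrite Cmod_pow; apply Rlt_le, HN, Hn.
Qed.

Lemma Cmod_pow_ge_1 (q : C) (k : nat) :
  (1 < Cmod q)%R -> (1 <= Cmod (q ^ k))%R.
Proof.
intros Hq; rewrite Cmod_pow; apply pow_R1_Rle; lra.
Qed.

Lemma Cmod_sub_le (x y : C) : (Cmod (x - y) <= Cmod x + Cmod y)%R.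
Proof.
rewrite <- (Cmod_opp y); apply Cmod_triangle.
Qed.

Lemma Cmod_sub_ge (x y : C) : (Cmod y - Cmod x <= Cmod (x - y))%R.
Proof.
generalize (Cmod_triangle x (- (x - y))); rewrite Cmod_opp.
replace (x + - (x - y)) with y by ring; lra.
Qed.

Lemma phi_term_ratio_le (A B U V q : C) (r : R) (k : nat) :
  (forall j, 1 - U * q ^ j <> 0) -> (forall j, 1 - V * q ^ j <> 0) ->
  (Cmod q * Cmod (1 - A * q ^ k) * Cmod (1 - B * q ^ k) <=
     r * (Cmod (1 - U * q ^ k) * Cmod (1 - V * q ^ k)))%R ->
  (Cmod (phi_term A B U V q (S k)) <= r * Cmod (phi_term A B U V q k))%R.
Proof.
intros HU HV Hr; rewrite phi_term_S by auto.
rewrite Cmod_mult, Cmod_div by (apply Cmult_neq_0; auto).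
rewrite !Cmod_mult.
apply Rmult_le_compat_r; [apply Cmod_ge_0|].
apply Rle_div_l; [|exact Hr].
apply Rmult_lt_0_compat; apply Cmod_gt_0; auto.
Qed.

(** Since q^k tends to infinity, the quotient of successive terms tends to A B q / (U V), which the
    convergence hypothesis places inside the unit disc. *)
Lemma phi_term_geometric (A B U V q : C) :
  (1 < Cmod q)%R -> U <> 0 -> V <> 0 ->
  (forall j, 1 - U * q ^ j <> 0) -> (forall j, 1 - V * q ^ j <> 0) ->
  (Cmod (A * B * q) < Cmod (U * V))%R ->
  exists M r, (0 < r < 1)%R /\
    forall k, (Cmod (phi_term A B U V q k) <= M * r ^ k)%R.
Proof.
intros Hq U0 V0 HU HV.
rewrite !Cmod_mult; intros Hconv.
apply Cmod_gt_0 in U0; apply Cmod_gt_0 in V0.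
assert (a0 := Cmod_ge_0 A); assert (b0 := Cmod_ge_0 B).
set (e := (Cmod U * Cmod V - Cmod A * Cmod B * Cmod q)%R).
set (g := (Cmod U * Cmod V)%R).
assert (e0 : (0 < e)%R) by (unfold e; lra).
assert (g0 : (0 < g)%R) by (apply Rmult_lt_0_compat; lra).
assert (eg : (e <= g)%R).
{ unfold e, g; assert (0 <= Cmod A * Cmod B)%R by (apply Rmult_le_pos; lra); nra. }
(* The limiting ratio is 1 - e/g in modulus; [r] is its midpoint with 1, which leaves a margin e/2
   in the coefficient of |q^k|^2. *)
set (r := (1 - e / (2 * g))%R).
assert (rg : (r * g = g - e / 2)%R) by (unfold r; field; lra).
assert (r0 : (0 < r < 1)%R) by (split; nra).
(* The first threshold lets the margin (e/2) |q^k|^2 absorb all terms linear in |q^k|. The other two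
   make the lower bounds |U q^k| - 1 and |V q^k| - 1 nonnegative. *)
destruct (eventually_pow_ge q
  ((Cmod q * (1 + Cmod A + Cmod B) + Cmod U + Cmod V) * 2 / e) Hq) as [N1 H1].
destruct (eventually_pow_ge q (/ Cmod U) Hq) as [N2 H2].
destruct (eventually_pow_ge q (/ Cmod V) Hq) as [N3 H3].
destruct (eventually_geometric (phi_term A B U V q) r (N1 + N2 + N3)) as [M HM].
- lra.
- intros k Hk; apply phi_term_ratio_le; auto.
  specialize (H1 k ltac:(lia)); specialize (H2 k ltac:(lia));
    specialize (H3 k ltac:(lia)).
  assert (X1 := Cmod_pow_ge_1 q k Hq).
  assert (LA := Cmod_sub_le 1 (A * q ^ k)); assert (LB := Cmod_sub_le 1 (B * q ^ k)).
  assert (LU := Cmod_sub_ge 1 (U * q ^ k)); assert (LV := Cmod_sub_ge 1 (V * q ^ k)).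
  rewrite Cmod_1, Cmod_mult in LA, LB, LU, LV.
  revert H1 H2 H3 X1 LA LB LU LV.
  generalize (Cmod_ge_0 (1 - A * q ^ k)) (Cmod_ge_0 (1 - B * q ^ k)).
  generalize (Cmod (q ^ k)) (Cmod (1 - A * q ^ k)) (Cmod (1 - B * q ^ k))
    (Cmod (1 - U * q ^ k)) (Cmod (1 - V * q ^ k)).
  intros X a b u v pa pb H1 H2 H3 X1 LA LB LU LV.
  apply Rle_div_l in H1; [|lra].
  assert (HU1 : (1 <= Cmod U * X)%R).
  { apply (Rmult_le_compat_l (Cmod U)) in H2; [|lra].
    rewrite Rinv_r in H2; lra. }
  assert (HV1 : (1 <= Cmod V * X)%R).
  { apply (Rmult_le_compat_l (Cmod V)) in H3; [|lra].
    rewrite Rinv_r in H3; lra. }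
  apply Rle_trans with (Cmod q * ((1 + Cmod A * X) * (1 + Cmod B * X)))%R.
  { rewrite Rmult_assoc; apply Rmult_le_compat_l; [lra|].
    apply Rmult_le_compat; lra. }
  apply Rle_trans with (r * ((Cmod U * X - 1) * (Cmod V * X - 1)))%R.
  2: { apply Rmult_le_compat_l; [lra|]; apply Rmult_le_compat; lra. }
  assert (E1 : (Cmod q * ((1 + Cmod A * X) * (1 + Cmod B * X)) <=
    Cmod q * (Cmod A * Cmod B) * (X * X) + Cmod q * (1 + Cmod A + Cmod B) * X)%R)
    by nra.
  assert (E2 : (r * g * (X * X) - (Cmod U + Cmod V) * X <=
    r * ((Cmod U * X - 1) * (Cmod V * X - 1)))%R).
  { unfold g; assert (0 <= (1 - r) * ((Cmod U + Cmod V) * X))%R; [|nra].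
    apply Rmult_le_pos; [lra|]; apply Rmult_le_pos; lra. }
  rewrite rg in E2.
  apply (Rmult_le_compat_r X) in H1; [|lra].
  unfold e in *; unfold g in *; nra.
- exists M, r; auto.
Qed.

Lemma phi_term_uniform (A B U V q : C) :
  (1 < Cmod q)%R ->
  (forall j, 1 - U * q ^ j <> 0) -> (forall j, 1 - V * q ^ j <> 0) ->
  (2 <= Cmod U)%R -> (2 <= Cmod V)%R ->
  (8 * Cmod q * (1 + Cmod A) * (1 + Cmod B) <= Cmod U * Cmod V)%R ->
  (Cmod (CSeries (phi_term A B U V q)) <= 2)%R.
Proof.
(* The hypotheses make every term at most half the previous one. *)
intros Hq HU HV U2 V2 Hbig.
assert (a0 := Cmod_ge_0 A); assert (b0 := Cmod_ge_0 B).
replace 2%R with (1 / (1 - / 2))%R by field.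
apply geometric_CSeries_le; [lra|].
induction k as [|k IH].
- unfold phi_term; simpl. replace (1 * 1 / (1 * 1) * 1) with (RtoC 1) by field.
  rewrite Cmod_1; lra.
- apply Rle_trans with (/ 2 * Cmod (phi_term A B U V q k))%R; [|simpl; lra].
  apply phi_term_ratio_le; auto.
  assert (X1 := Cmod_pow_ge_1 q k Hq).
  assert (LA := Cmod_sub_le 1 (A * q ^ k)); assert (LB := Cmod_sub_le 1 (B * q ^ k)).
  assert (LU := Cmod_sub_ge 1 (U * q ^ k)); assert (LV := Cmod_sub_ge 1 (V * q ^ k)).
  rewrite Cmod_1, Cmod_mult in LA, LB, LU, LV.
  revert X1 LA LB LU LV.
  generalize (Cmod_ge_0 (1 - A * q ^ k)) (Cmod_ge_0 (1 - B * q ^ k)).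
  generalize (Cmod (q ^ k)) (Cmod (1 - A * q ^ k)) (Cmod (1 - B * q ^ k))
    (Cmod (1 - U * q ^ k)) (Cmod (1 - V * q ^ k)).
  intros X a b u v pa pb X1 LA LB LU LV.
  apply Rle_trans with (Cmod q * (((1 + Cmod A) * X) * ((1 + Cmod B) * X)))%R.
  { rewrite Rmult_assoc; apply Rmult_le_compat_l; [lra|].
    apply Rmult_le_compat; nra. }
  (* As |U|, |V| >= 2, the moduli of 1 - U q^k and 1 - V q^k are at least half of |U q^k| and |V
     q^k|. These two halves and the ratio 1/2 make up the constant 8. *)
  apply Rle_trans with (/ 2 * ((Cmod U * X / 2) * (Cmod V * X / 2)))%R.
  2: { apply Rmult_le_compat_l; [lra|]; apply Rmult_le_compat; nra. }
  assert (0 <= X * X)%R by nra.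
  apply (Rmult_le_compat_r (X * X)) in Hbig; auto; lra.
Qed.

(** Numerator and denominator of the rational prefactor of [cert] both have order at most and
    exactly q^(2k) respectively, so the prefactor is bounded and the decay comes from the term. *)
Lemma cert_lim (A B U V q : C) :
  (1 < Cmod q)%R -> U <> 0 -> V <> 0 ->
  (forall j, 1 - U * q ^ j <> 0) -> (forall j, 1 - V * q ^ j <> 0) ->
  (Cmod (A * B * q) < Cmod (U * V))%R ->
  is_lim_seq (fun k => Cmod (cert A B U V q k)) 0.
Proof.
intros Hq U0 V0 HU HV Hconv.
destruct (phi_term_geometric A B U V q) as [M [r [Hr HM]]]; auto.
assert (q0 : q <> 0) by (apply Cmod_gt_0; lra).
apply Cmod_gt_0 in V0.
set (c := (Cmod (cert0 A B U V q) + Cmod (cert1 A B U V q)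
           + Cmod (cert2 A B U V))%R).
(* The factor 2 / |V| comes from |1 - V q^k| >= |V q^k| / 2, valid once |q^k| >= 2 / |V|. *)
apply (is_lim_seq_Cmod_0 _ (fun k => c * (2 / Cmod V) * M * r ^ k)%R);
  [|now apply is_lim_seq_geom_scal].
destruct (eventually_pow_ge q (2 / Cmod V) Hq) as [N HN].
exists N; intros k Hk; specialize (HN k Hk).
apply Rle_div_l in HN; [|exact V0].
assert (X1 := Cmod_pow_ge_1 q k Hq).
assert (LV := Cmod_sub_ge 1 (V * q ^ k)).
rewrite Cmod_1, Cmod_mult in LV.
unfold cert; rewrite Cmod_mult, (Rmult_assoc _ M).
apply Rmult_le_compat; auto using Cmod_ge_0.
assert (qk : q ^ k <> 0) by now apply Cpow_nz.
rewrite Cmod_div, Cmod_mult by now apply Cmult_neq_0.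
set (X := Cmod (q ^ k)) in *.
apply Rle_div_l.
{ apply Rmult_lt_0_compat; [lra|]; apply Cmod_gt_0; auto. }
apply Rle_trans with (c * (X * X))%R.
- eapply Rle_trans; [apply Cmod_triangle|].
  eapply Rle_trans; [apply Rplus_le_compat_r, Cmod_triangle|].
  rewrite !Cmod_mult; fold X; unfold c.
  assert (m0 := Cmod_ge_0 (cert0 A B U V q)).
  assert (m1 := Cmod_ge_0 (cert1 A B U V q)).
  assert (X <= X * X)%R by nra.
  assert (1 <= X * X)%R by nra.
  nra.
- replace (c * (X * X))%R
    with (c * (2 / Cmod V) * (X * (Cmod V * X / 2)))%R by (field; lra).
  apply Rmult_le_compat_l.
  + apply Rmult_le_pos; [|apply Rlt_le, Rdiv_lt_0_compat; lra].
    unfold c; repeat apply Rplus_le_le_0_compat; apply Cmod_ge_0.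
  + apply Rmult_le_compat_l; [lra|]. lra.
Qed.

(** * The contiguous relation *)

Lemma one_sub_shift_neq_0 (x q : C) :
  (forall j, 1 - x * q ^ j <> 0) -> forall j, 1 - x * q * q ^ j <> 0.
Proof.
intros H j E; apply (H (S j)); rewrite <- E; simpl; ring.
Qed.

(** The left side gains a factor |x| and the right side |x|^3, so convergence persists along the
    iteration. *)
Lemma conv_shift (A B U V q x : C) :
  (1 <= Cmod x)%R -> (Cmod (A * B * q) < Cmod (U * V))%R ->
  (Cmod (A * (B * x) * q) < Cmod (U * x * (V * (x * x))))%R.
Proof.
intros Hx Hconv.
replace (A * (B * x) * q) with (A * B * q * x) by ring.
replace (U * x * (V * (x * x))) with (U * V * x * (x * x)) by ring.
rewrite (Cmod_mult (_ * q)), (Cmod_mult (_ * x)), (Cmod_mult (U * V)), (Cmod_mult x).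
assert (H0 := Cmod_ge_0 (A * B * q)).
apply Rlt_le_trans with (Cmod (U * V) * Cmod x)%R.
- apply Rmult_lt_compat_r; lra.
- assert (0 <= Cmod (U * V) * Cmod x)%R by (apply Rmult_le_pos; lra).
  assert (1 <= Cmod x * Cmod x)%R by nra.
  nra.
Qed.

(** Sum [cert_telescopes] over k: as [cert] tends to 0, the right side collapses to (1 - V) times
    its value at k = 0. *)
Lemma phi_contiguous (A B U V q : C) :
  (1 < Cmod q)%R -> U <> 0 -> V <> 0 ->
  (forall j, 1 - U * q ^ j <> 0) -> (forall j, 1 - V * q ^ j <> 0) ->
  (Cmod (A * B * q) < Cmod (U * V))%R ->
  weight A B U V q * CSeries (phi_term A B U V q) =
  boundary A B U V q +
  factor A B U V q * CSeries (phi_term A (B * q) (U * q) (V * q * q) q).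
Proof.
intros Hq U0 V0 HU HV Hconv.
assert (q0 : q <> 0) by (apply Cmod_gt_0; lra).
destruct (phi_term_geometric A B U V q) as [M [r [Hr HM]]]; auto.
destruct (phi_term_geometric A (B * q) (U * q) (V * q * q) q)
  as [M' [r' [Hr' HM']]]; auto using one_sub_shift_neq_0, Cmult_neq_0.
{ rewrite <- (Cmult_assoc V); apply conv_shift; auto; lra. }
assert (S1 := geometric_is_series _ _ _ Hr HM).
assert (S2 := geometric_is_series _ _ _ Hr' HM').
apply (is_series_scal (V := C_NormedModule) (weight A B U V q)) in S1.
apply (is_series_scal (V := C_NormedModule) (- factor A B U V q)) in S2.
assert (S12 := is_series_plus _ _ _ _ S1 S2).
assert (S3 := is_series_telescope _ (cert_lim A B U V q Hq U0 V0 HU HV Hconv)).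
apply (is_series_scal (V := C_NormedModule) (1 - V)) in S3.
apply CSeries_unique in S12; apply CSeries_unique in S3.
assert (E : forall u v : nat -> C, (forall k, u k = v k) -> CSeries u = CSeries v).
{ intros u v H; unfold CSeries; f_equal; apply Series_ext; intros k; now rewrite H. }
assert (S0 : weight A B U V q * CSeries (phi_term A B U V q) +
  - factor A B U V q * CSeries (phi_term A (B * q) (U * q) (V * q * q) q) =
  (1 - V) * cert A B U V q 0).
{ transitivity
    (CSeries (fun n => (1 - V) * (cert A B U V q n - cert A B U V q (S n))));
    [|exact S3].
  symmetry; etransitivity; [|exact S12].
  apply E; intros k; rewrite <- cert_telescopes by auto.
  unfold scal, plus; simpl; unfold mult; simpl; ring. }
assert (V1 : 1 - V <> 0) by (intros E'; apply (HV O); simpl; rewrite <- E'; ring).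
assert (B0 : boundary A B U V q = (1 - V) * cert A B U V q 0).
{ unfold boundary, cert, phi_term; simpl; field; auto. }
rewrite B0, <- S0; ring.
Qed.

(** * Iteration along the parameters (A, B q^n, U q^n, V q^(2n)) *)

Definition weight_at (A B U V q : C) (n : nat) : C :=
  weight A (B * q ^ n) (U * q ^ n) (V * (q ^ n * q ^ n)) q.
Definition factor_at (A B U V q : C) (n : nat) : C :=
  factor A (B * q ^ n) (U * q ^ n) (V * (q ^ n * q ^ n)) q.
Definition boundary_at (A B U V q : C) (n : nat) : C :=
  boundary A (B * q ^ n) (U * q ^ n) (V * (q ^ n * q ^ n)) q.
Definition phi_at (A B U V q : C) (n : nat) : C :=
  CSeries (phi_term A (B * q ^ n) (U * q ^ n) (V * (q ^ n * q ^ n)) q).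

Lemma phi_at_contiguous (A B U V q : C) (n : nat) :
  (1 < Cmod q)%R -> U <> 0 -> V <> 0 ->
  (forall j, 1 - U * q ^ j <> 0) -> (forall j, 1 - V * q ^ j <> 0) ->
  (Cmod (A * B * q) < Cmod (U * V))%R ->
  weight_at A B U V q n * phi_at A B U V q n =
  boundary_at A B U V q n + factor_at A B U V q n * phi_at A B U V q (S n).
Proof.
intros Hq U0 V0 HU HV Hconv.
assert (qn : q ^ n <> 0) by (apply Cpow_nz, Cmod_gt_0; lra).
unfold weight_at, phi_at, boundary_at, factor_at.
replace (B * q ^ S n) with (B * q ^ n * q) by (simpl; ring).
replace (U * q ^ S n) with (U * q ^ n * q) by (simpl; ring).
replace (V * (q ^ S n * q ^ S n)) with (V * (q ^ n * q ^ n) * q * q)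
  by (simpl; ring).
apply phi_contiguous; auto using Cmult_neq_0.
- intros j; rewrite <- Cmult_assoc, <- Cpow_add_r; apply HU.
- intros j; rewrite <- Cmult_assoc, <- !Cpow_add_r; apply HV.
- apply conv_shift; auto using Cmod_pow_ge_1.
Qed.

(** In the size condition of [phi_term_uniform] the right side grows like |q|^(3n) and the left side
    at most like |q|^n, so the condition holds for large n. *)
Lemma phi_at_bounded (A B U V q : C) :
  (1 < Cmod q)%R -> U <> 0 -> V <> 0 ->
  (forall j, 1 - U * q ^ j <> 0) -> (forall j, 1 - V * q ^ j <> 0) ->
  eventually (fun n => (Cmod (phi_at A B U V q n) <= 2)%R).
Proof.
intros Hq U0 V0 HU HV.
apply Cmod_gt_0 in U0; apply Cmod_gt_0 in V0.
assert (a0 := Cmod_ge_0 A); assert (b0 := Cmod_ge_0 B).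
assert (g0 : (0 < Cmod U * Cmod V)%R) by (apply Rmult_lt_0_compat; lra).
destruct (eventually_pow_ge q (2 / Cmod U) Hq) as [N1 H1].
destruct (eventually_pow_ge q (2 / Cmod V) Hq) as [N2 H2].
destruct (eventually_pow_ge q
  (8 * Cmod q * (1 + Cmod A) * (1 + Cmod B) / (Cmod U * Cmod V)) Hq) as [N3 H3].
exists (N1 + N2 + N3)%nat; intros n Hn.
specialize (H1 n ltac:(lia)); specialize (H2 n ltac:(lia));
  specialize (H3 n ltac:(lia)).
apply Rle_div_l in H1; [|lra].
apply Rle_div_l in H2; [|lra].
apply Rle_div_l in H3; [|lra].
assert (X1 := Cmod_pow_ge_1 q n Hq).
apply phi_term_uniform; auto.
- intros j; rewrite <- Cmult_assoc, <- Cpow_add_r; apply HU.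
- intros j; rewrite <- Cmult_assoc, <- !Cpow_add_r; apply HV.
- rewrite Cmod_mult; lra.
- rewrite !Cmod_mult; nra.
- rewrite !Cmod_mult; set (X := Cmod (q ^ n)) in *.
  set (L := (8 * Cmod q * (1 + Cmod A))%R) in *.
  assert (0 <= L)%R by (unfold L; apply Rmult_le_pos; lra).
  apply Rle_trans with (L * (1 + Cmod B) * X)%R.
  { rewrite Rmult_assoc; apply Rmult_le_compat_l; [lra|nra]. }
  apply Rle_trans with (X * (Cmod U * Cmod V) * X)%R.
  { apply Rmult_le_compat_r; lra. }
  replace (Cmod U * X * (Cmod V * (X * X)))%R
    with (X * (Cmod U * Cmod V) * X * X)%R by ring.
  assert (0 <= X * (Cmod U * Cmod V) * X)%R; [|nra].
  repeat apply Rmult_le_pos; lra.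
Qed.

(** With X = |q^n|, K is O(X^5) while W has exact order X^8. The quotient is O(X^(-3)), and the
    bound 1/2 is all that the remainder estimate uses. *)
Lemma factor_weight_ratio (A B U V q : C) :
  (1 < Cmod q)%R -> U <> 0 -> V <> 0 ->
  (forall j, 1 - U * q ^ j <> 0) -> (forall j, 1 - V * q ^ j <> 0) ->
  (Cmod (A * B * q) < Cmod (U * V))%R ->
  eventually (fun n => (Cmod (factor_at A B U V q n)
                          <= / 2 * Cmod (weight_at A B U V q n))%R).
Proof.
intros Hq U0 V0 HU HV; rewrite !Cmod_mult; intros Hconv.
apply Cmod_gt_0 in U0; apply Cmod_gt_0 in V0.
assert (a0 := Cmod_ge_0 A); assert (b0 := Cmod_ge_0 B).
set (Q := Cmod q) in *.
set (al := Cmod A) in *; set (be := Cmod B) in *;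
set (ga := Cmod U) in *; set (de := Cmod V) in *.
set (e := (ga * de - al * be * Q)%R).
assert (e0 : (0 < e)%R) by (unfold e; lra).
(* [kap] X^8 bounds the numerator of K from above; [lam] X^11 / 8 bounds W times the denominator of
   K from below. Hence the threshold 16 [kap] / [lam]. *)
set (kap := (Q * (al + de) * (al + de * Q) * (al + ga) * (be + de) * (1 + be))%R).
assert (kap0 : (0 <= kap)%R).
{ unfold kap; repeat apply Rmult_le_pos; try lra.
  apply Rplus_le_le_0_compat; [lra|apply Rmult_le_pos; lra]. }
set (lam := (ga * (de * Q) * (de * (e * e)))%R).
assert (lam0 : (0 < lam)%R) by (unfold lam; repeat apply Rmult_lt_0_compat; lra).
destruct (eventually_pow_ge q (2 / ga) Hq) as [N1 H1].
destruct (eventually_pow_ge q (2 / de) Hq) as [N2 H2].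
destruct (eventually_pow_ge q (16 * kap / lam) Hq) as [N3 H3].
exists (N1 + N2 + N3)%nat; intros n Hn.
specialize (H1 n ltac:(lia)); specialize (H2 n ltac:(lia));
  specialize (H3 n ltac:(lia)).
apply Rle_div_l in H1; [|lra].
apply Rle_div_l in H2; [|lra].
apply Rle_div_l in H3; [|lra].
assert (X1 := Cmod_pow_ge_1 q n Hq).
assert (NU : 1 - U * q ^ n <> 0) by auto.
assert (NV : 1 - V * (q ^ n * q ^ n) * q <> 0).
{ replace (V * (q ^ n * q ^ n) * q) with (V * q ^ S (n + n))
    by (simpl; rewrite Cpow_add_r; ring). apply HV. }
unfold factor_at, weight_at, factor, weight.
set (x := q ^ n) in *.
rewrite Cmod_div by now apply Cmult_neq_0.
apply Rle_div_l.
{ apply Cmod_gt_0; now apply Cmult_neq_0. }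
assert (F1 := Cmod_sub_le A (V * (x * x))).
assert (F2 := Cmod_sub_le A (V * (x * x) * q)).
assert (F3 := Cmod_sub_le A (U * x)).
assert (F4 := Cmod_sub_le (B * x) (V * (x * x))).
assert (F5 := Cmod_sub_le 1 (B * x)).
assert (G1 := Cmod_sub_ge 1 (U * x)).
assert (G2 := Cmod_sub_ge 1 (V * (x * x) * q)).
assert (G3 := Cmod_sub_ge 1 (V * (x * x))).
assert (G4 := Cmod_sub_ge (A * (B * x)) (U * x * (V * (x * x)))).
assert (G5 := Cmod_sub_ge (A * (B * x) * q) (U * x * (V * (x * x)))).
rewrite <- (Cmod_opp (_ - _)) in G4.
rewrite <- (Cmod_opp (_ - _)) in G5.
replace (- (A * (B * x) - U * x * (V * (x * x))))
  with (U * x * (V * (x * x)) - A * (B * x)) in G4 by ring.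
replace (- (A * (B * x) * q - U * x * (V * (x * x))))
  with (U * x * (V * (x * x)) - A * (B * x) * q) in G5 by ring.
revert F1 F2 F3 F4 F5 G1 G2 G3 G4 G5.
rewrite !Cmod_mult, !Cmod_opp, Cmod_1.
generalize (Cmod_ge_0 (A - V * (x * x))) (Cmod_ge_0 (A - V * (x * x) * q))
  (Cmod_ge_0 (A - U * x)) (Cmod_ge_0 (B * x - V * (x * x)))
  (Cmod_ge_0 (1 - B * x)).
generalize (Cmod (A - V * (x * x))) (Cmod (A - V * (x * x) * q))
  (Cmod (A - U * x)) (Cmod (B * x - V * (x * x))) (Cmod (1 - B * x))
  (Cmod (1 - U * x)) (Cmod (1 - V * (x * x) * q)) (Cmod (1 - V * (x * x)))
  (Cmod (U * x * (V * (x * x)) - A * (B * x)))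
  (Cmod (U * x * (V * (x * x)) - A * (B * x) * q)).
fold Q al be ga de; revert H1 H2 H3 X1; generalize (Cmod x).
intros X H1 H2 H3 X1 f1 f2 f3 f4 f5 g1 g2 g3 g4 g5 p1 p2 p3 p4 p5
  F1 F2 F3 F4 F5 G1 G2 G3 G4 G5.
assert (XX : (X <= X * X)%R) by nra.
assert (deX : (2 <= de * (X * X))%R) by nra.
assert (deQ : (2 <= de * (X * X) * Q)%R) by nra.
assert (aX : (al <= al * (X * X))%R) by nra.
assert (aX1 : (al <= al * X)%R) by nra.
assert (bX : (be * X <= be * (X * X))%R) by (apply Rmult_le_compat_l; lra).
apply Rle_trans with (Q * ((al + de) * (X * X)) * ((al + de * Q) * (X * X)) *
  ((al + ga) * X) * ((be + de) * (X * X)) * ((1 + be) * X))%R.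
{ repeat apply Rmult_le_compat; repeat apply Rmult_le_pos; nra. }
apply Rle_trans with (/ 2 * ((de * (X * X) / 2) * (e * (X * (X * X))) *
  (e * (X * (X * X)))) * ((ga * X / 2) * (de * (X * X) * Q / 2)))%R.
2: {
  assert (XXX : (X <= X * (X * X))%R) by nra.
  assert (ab0 : (0 <= al * be)%R) by (apply Rmult_le_pos; lra).
  assert (abQ : (al * be <= al * be * Q)%R) by nra.
  assert (abQ0 : (0 <= al * be * Q)%R) by lra.
  (* Since X >= 1, the subtracted term is at most |A B q| X^3, so [e] X^3 remains: the convergence
     hypothesis keeps these two factors of W away from 0. *)
  assert (E4 : (e * (X * (X * X)) <= g4)%R).
  { eapply Rle_trans; [|exact G4]; unfold e.
    assert (al * be * X <= al * be * Q * (X * (X * X)))%R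
      by (apply Rmult_le_compat; lra).
    lra. }
  assert (E5 : (e * (X * (X * X)) <= g5)%R).
  { eapply Rle_trans; [|exact G5]; unfold e.
    assert (al * be * Q * X <= al * be * Q * (X * (X * X)))%R
      by (apply Rmult_le_compat_l; lra).
    lra. }
  assert (0 <= e * (X * (X * X)))%R by (apply Rmult_le_pos; lra).
  repeat apply Rmult_le_compat; try (repeat apply Rmult_le_pos; lra); lra. }
assert (X8 : (0 <= X * X * (X * X) * (X * X) * (X * X))%R)
  by (repeat apply Rmult_le_pos; lra).
assert (X2 : (1 <= X * X)%R) by nra.
assert (L : (16 * kap <= lam * (X * (X * X)))%R).
{ assert (0 <= lam * X)%R by (apply Rmult_le_pos; lra). nra. }
apply (Rmult_le_compat_r _ _ _ X8) in L.
unfold kap, lam in L; lra.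
Qed.

(** Put r n = w n W_n S_n. The recurrence for [w] turns the contiguous relation times w n into w n
    P_n = r n - r (n+1). Eventually w n W_n at least halves at each step and |S_n| <= 2, so r tends
    to 0. *)
Lemma accelerated_is_series (A B U V q : C) (w : nat -> C) :
  (1 < Cmod q)%R -> U <> 0 -> V <> 0 ->
  (forall j, 1 - U * q ^ j <> 0) -> (forall j, 1 - V * q ^ j <> 0) ->
  (Cmod (A * B * q) < Cmod (U * V))%R ->
  (forall n, w (S n) * weight_at A B U V q (S n) = w n * factor_at A B U V q n) ->
  is_series (fun n => w n * boundary_at A B U V q n)
    (w O * weight_at A B U V q 0 * phi_at A B U V q 0).
Proof.
intros Hq U0 V0 HU HV Hconv Hw.
eapply is_series_ext;
  [|apply (is_series_telescope
      (fun n => w n * weight_at A B U V q n * phi_at A B U V q n))].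
- intros n; simpl; rewrite Hw, <- (Cmult_assoc (w n)), phi_at_contiguous by auto.
  ring.
- destruct (factor_weight_ratio A B U V q) as [N HN]; auto.
  destruct (eventually_geometric (fun n => w n * weight_at A B U V q n) (/ 2) N)
    as [M HM]; [lra| |].
  { intros k Hk; rewrite Hw, !Cmod_mult.
    specialize (HN k Hk); assert (W := Cmod_ge_0 (w k)).
    apply (Rmult_le_compat_l _ _ _ W) in HN; lra. }
  apply (is_lim_seq_Cmod_0 _ (fun n => M * 2 * (/ 2) ^ n)%R).
  + destruct (phi_at_bounded A B U V q) as [N' HN']; auto.
    exists N'; intros n Hn; rewrite Cmod_mult.
    apply Rle_trans with (M * (/ 2) ^ n * 2)%R; [|lra].
    apply Rmult_le_compat; auto using Cmod_ge_0.
  + apply is_lim_seq_geom_scal; lra.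
Qed.

(** * Complex powers of q *)

Lemma Cexp_add (x y : C) : Cexp (x + y) = Cexp x * Cexp y.
Proof.
destruct x as [x1 x2], y as [y1 y2]; unfold Cexp, Cmult; simpl.
rewrite exp_plus, cos_plus, sin_plus; f_equal; ring.
Qed.

Lemma Cexp_0 : Cexp 0 = 1.
Proof.
unfold Cexp; simpl; rewrite exp_0, cos_0, sin_0; unfold RtoC; f_equal; ring.
Qed.

Lemma qpow_add (lq x y : C) : qpow lq (x + y) = qpow lq x * qpow lq y.
Proof.
unfold qpow; rewrite <- Cexp_add; f_equal; ring.
Qed.

Lemma qpow_0 (lq : C) : qpow lq 0 = 1.
Proof.
unfold qpow; rewrite <- Cexp_0; f_equal; ring.
Qed.

Lemma qpow_neq_0 (lq x : C) : qpow lq x <> 0.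
Proof.
intros H; apply C1_nz.
rewrite <- (qpow_0 lq); replace (RtoC 0) with (x + - x) at 1 by ring.
rewrite qpow_add, H; ring.
Qed.

Lemma qpow_opp (lq x : C) : qpow lq (- x) = / qpow lq x.
Proof.
assert (H := qpow_neq_0 lq x).
transitivity (qpow lq (- x + x) / qpow lq x).
- rewrite qpow_add; field; auto.
- replace (- x + x) with (RtoC 0) by ring.
  rewrite qpow_0; field; auto.
Qed.

Lemma qpow_sub (lq x y : C) : qpow lq (x - y) = qpow lq x / qpow lq y.
Proof.
unfold Cminus; rewrite qpow_add, qpow_opp; reflexivity.
Qed.

Lemma nC_S (n : nat) : nC (S n) = nC n + 1.
Proof.
unfold nC; now rewrite S_INR, RtoC_plus.
Qed.

Lemma qpow_nat (lq x : C) (n : nat) : qpow lq (nC n * x) = qpow lq x ^ n.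
Proof.
induction n as [|n IH].
- replace (nC 0 * x) with (RtoC 0) by (unfold nC; simpl; ring).
  apply qpow_0.
- rewrite nC_S, Cmult_plus_distr_r, qpow_add, IH, Cmult_1_l; simpl; ring.
Qed.

(** Handles the numeral coefficients in the exponents of [p], such as 2 * d or 7 * n. *)
Lemma qpow_pos (lq x : C) (m : positive) :
  qpow lq (RtoC (IZR (Zpos m)) * x) = qpow lq x ^ Pos.to_nat m.
Proof.
rewrite <- qpow_nat; unfold nC; now rewrite INR_IZR_INZ, positive_nat_Z.
Qed.

(** * The weights of the accelerated series and their match with the stated terms *)

(* [E n] stands for q^(- n (n - 1) / 2); only its recurrence matters. The last
   factor q^(-n) appears because the bracket of p(n) is q^(-n) times
   [boundary_at] at n. *)
Definition accel_weight (A B U V q : C) (E : nat -> C) (n : nat) : C :=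
  (- (1)) ^ n * E n *
  (qpoch (V / A) (q ^ 2) n * qpoch (V / A * q) (q ^ 2) n /
   (qpoch (V * q) (q ^ 2) n * qpoch (V * (q * q)) (q ^ 2) n *
    qpoch (U * V / A / B * q) (q ^ 2) n *
    qpoch (U * V / A / B * (q * q)) (q ^ 2) n)) *
  (qpoch B q n * qpoch (U / A) q n * qpoch (V / B) q n / qpoch U q n) *
  (A / B / q) ^ n / q ^ n.

(** Up to monomials, the factors of K at n and of W at n + 1 are the new factors of the shifted
    factorials. For instance, W at n + 1 contributes 1 - V q^(2n+2) and the two factors with U V /
    (A B). The monomials are matched by the sign, [E] and the n-th powers. *)
Lemma accel_weight_S (A B U V q : C) (E : nat -> C) (n : nat) :
  A <> 0 -> B <> 0 -> q <> 0 ->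
  (forall k, E (S k) = E k / q ^ k) ->
  (forall k, qpoch U q k <> 0) ->
  (forall k, qpoch (V * q) (q ^ 2) k * qpoch (V * (q * q)) (q ^ 2) k *
    qpoch (U * V / A / B * q) (q ^ 2) k *
    qpoch (U * V / A / B * (q * q)) (q ^ 2) k <> 0) ->
  accel_weight A B U V q E (S n) * weight_at A B U V q (S n) =
  accel_weight A B U V q E n * factor_at A B U V q n.
Proof.
intros A0 B0 q0 HE HU Hden.
assert (qn : q ^ n <> 0) by now apply Cpow_nz.
assert (Ub := HU n); assert (Uf := qpoch_factor_neq_0 _ _ _ (HU (S n))).
assert (split4 : forall x y z t : C, x * y * z * t <> 0 ->
  x <> 0 /\ y <> 0 /\ z <> 0 /\ t <> 0).
{ intros x y z t H; repeat split; intros H0; apply H; rewrite H0; ring. }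
destruct (split4 _ _ _ _ (Hden n)) as [D1 [D2 [D3 D4]]].
destruct (split4 _ _ _ _ (Hden (S n))) as [F1 [F2 [F3 F4]]].
apply qpoch_factor_neq_0 in F1, F2, F3, F4.
assert (q2n : (q ^ 2) ^ n = q ^ n * q ^ n).
{ rewrite <- Cpow_mult_r, <- Cpow_add_r; f_equal; lia. }
unfold accel_weight, weight_at, factor_at, weight, factor; rewrite HE.
assert (qpoch_S : forall x Q : C,
  qpoch x Q (S n) = qpoch x Q n * (1 - x * Q ^ n)) by reflexivity.
rewrite !qpoch_S; rewrite q2n in F1, F2, F3, F4 |- *.
rewrite (Cpow_S q n), (Cpow_S (- (1))), (Cpow_S (A / B / q)).
revert qn Ub Uf D1 D2 D3 D4 F1 F2 F3 F4; clear - A0 B0 q0.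
generalize (q ^ n) (qpoch U q n) (qpoch (V * q) (q ^ 2) n)
  (qpoch (V * (q * q)) (q ^ 2) n) (qpoch (U * V / A / B * q) (q ^ 2) n)
  (qpoch (U * V / A / B * (q * q)) (q ^ 2) n)
  (qpoch (V / A) (q ^ 2) n) (qpoch (V / A * q) (q ^ 2) n).
intros x u d1 d2 d3 d4 v1 v2 qn Ub Uf D1 D2 D3 D4 F1 F2 F3 F4.
(* The same nonvanishing with the inner quotient U V / (A B) cleared, as [field] asks for it. *)
assert (F3' : A * B - U * V * q * (x * x) <> 0).
{ intros H; apply F3.
  transitivity ((A * B - U * V * q * (x * x)) / (A * B)); [field; auto|].
  rewrite H; field; auto. }
assert (F4' : A * B - U * V * (q * q) * (x * x) <> 0).
{ intros H; apply F4.
  transitivity ((A * B - U * V * (q * q) * (x * x)) / (A * B)); [field; auto|].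
  rewrite H; field; auto. }
field; repeat split; auto.
replace (V * (x * x) * q) with (V * q * (x * x)) by ring; exact F1.
Qed.

Lemma qpow_gauss_S (lq : C) (n : nat) :
  qpow lq (- (nC (S n) * (nC (S n) - 1) / 2)) =
  qpow lq (- (nC n * (nC n - 1) / 2)) / qpow lq 1 ^ n.
Proof.
rewrite <- qpow_nat, <- qpow_sub, nC_S; f_equal; field.
Qed.

Lemma p_boundary (q lq a b c d : C) (n : nat) :
  q = qpow lq 1 ->
  p lq a b c d n =
  (qpow lq a / qpow lq b / q) ^ n / q ^ n *
    boundary_at (qpow lq a) (qpow lq b) (qpow lq c) (qpow lq d) q n.
Proof.
intros ->.
assert (qn : qpow lq 1 ^ n <> 0) by (apply Cpow_nz, qpow_neq_0).
assert (qnE : qpow lq (nC n) = qpow lq 1 ^ n)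
  by (rewrite <- qpow_nat; f_equal; ring).
unfold p, boundary_at, boundary, cert0, cert1, cert2; cbv zeta.
rewrite qpow_nat, !qpow_sub.
(* Once the common power (A / (B q))^n is stripped, the bracket of p(n) is compared with q^(-n)
   times the boundary value, both expressed through x = q^n. *)
unfold Cdiv at 3; rewrite <- Cmult_assoc; f_equal.
rewrite !qpow_add, !qpow_pos, qnE.
generalize dependent (qpow lq 1 ^ n); intros x qn qnE.
cbv [Pos.to_nat Pos.iter_op Init.Nat.add Cpow].
field; auto.
Qed.

Theorem theorem2 (q lq a b c d : C)
  (q_gt1 : (1 < Cmod q)%R)
  (lqE : Cexp lq = q)
  (conv : (Cmod (qpow lq (a + b + 1) / qpow lq (c + d)) < 1)%R)
  (den_phi : forall n : nat, phi32_den (qpow lq c) (qpow lq d) q n <> 0)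
  (den_accel : forall n : nat, accel_den lq q a b c d n <> 0)
  (den_c : forall n : nat, qpoch (qpow lq c) q n <> 0) :
  ex_series (phi32_term (qpow lq a) (qpow lq b) q (qpow lq c) (qpow lq d) q q) /\
  ex_series (accel_term lq q a b c d) /\
  (1 - qpow lq d) * (qpow lq (c + d) - qpow lq (a + b)) *
    (qpow lq (c + d) - qpow lq (a + b + 1)) *
    phi32 (qpow lq a) (qpow lq b) q (qpow lq c) (qpow lq d) q q
  = CSeries (accel_term lq q a b c d).
Proof.
assert (q1 : q = qpow lq 1).
{ rewrite <- lqE; unfold qpow; f_equal; ring. }
assert (q0 : q <> 0) by (apply Cmod_gt_0; lra).
set (A := qpow lq a) in *; set (B := qpow lq b) in *;
set (U := qpow lq c) in *; set (V := qpow lq d) in *.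
assert (A0 : A <> 0) by apply qpow_neq_0.
assert (B0 : B <> 0) by apply qpow_neq_0.
assert (U0 : U <> 0) by apply qpow_neq_0.
assert (V0 : V <> 0) by apply qpow_neq_0.
assert (HU : forall j, 1 - U * q ^ j <> 0).
{ intros j; apply qpoch_factor_neq_0, den_c. }
assert (HV : forall j, 1 - V * q ^ j <> 0).
{ intros j; apply qpoch_factor_neq_0; intros H; apply (den_phi (S j)).
  unfold phi32_den; rewrite H; ring. }
assert (abE : qpow lq (a + b) = A * B) by apply qpow_add.
assert (cdE : qpow lq (c + d) = U * V) by apply qpow_add.
assert (ab1E : qpow lq (a + b + 1) = A * B * q)
  by (rewrite qpow_add, abE, q1; reflexivity).
assert (Hconv : (Cmod (A * B * q) < Cmod (U * V))%R).
{ revert conv; rewrite ab1E, cdE.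
  assert (UV0 : U * V <> 0) by now apply Cmult_neq_0.
  rewrite Cmod_div by auto; intros H.
  apply Cmod_gt_0 in UV0; apply Rlt_div_l in H; auto; lra. }
rewrite ab1E, cdE, abE.
assert (phiE : forall n, phi_term A B U V q n = phi32_term A B q U V q q n).
{ intros n; unfold phi_term, phi32_term, phi32_den.
  assert (Q : qpoch q q n <> 0)
    by (intros H; apply (den_phi n); unfold phi32_den; rewrite H; ring).
  assert (Vn := qpoch_neq_0 V q n HV).
  field; auto. }
destruct (phi_term_geometric A B U V q) as [M [r [Hr HM]]]; auto.
assert (S1 := geometric_is_series _ _ _ Hr HM).
apply (is_series_ext _ _ _ phiE) in S1.
set (E := fun n => qpow lq (- (nC n * (nC n - 1) / 2))).
assert (denE : forall n, accel_den lq q a b c d n =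
  qpoch (V * q) (q ^ 2) n * qpoch (V * (q * q)) (q ^ 2) n *
    qpoch (U * V / A / B * q) (q ^ 2) n *
    qpoch (U * V / A / B * (q * q)) (q ^ 2) n).
{ assert (q2 : qpow lq 2 = q * q).
  { rewrite q1, <- qpow_add; f_equal; ring. }
  intros n; unfold accel_den.
  rewrite !qpow_add, !qpow_sub, cdE, q2, <- q1; reflexivity. }
assert (S2 := accelerated_is_series A B U V q (accel_weight A B U V q E)
  q_gt1 U0 V0 HU HV Hconv).
assert (accelE : forall n,
  accel_weight A B U V q E n * boundary_at A B U V q n = accel_term lq q a b c d n).
{ intros n; unfold accel_weight, accel_term.
  rewrite (p_boundary q), denE, qpow_add, !qpow_sub, <- q1 by auto.
  unfold E, Cdiv; fold A B U V; ring. }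
assert (Hw : forall n, accel_weight A B U V q E (S n) * weight_at A B U V q (S n) =
  accel_weight A B U V q E n * factor_at A B U V q n).
{ intros n; apply accel_weight_S; auto.
  - intros k; unfold E; rewrite q1; apply qpow_gauss_S.
  - intros k; rewrite <- denE; apply den_accel. }
apply (is_series_ext _ _ _ accelE) in S2; [|exact Hw].
split; [eexists; exact S1|split; [eexists; exact S2|]].
rewrite (CSeries_unique _ _ S2); unfold phi32.
rewrite (CSeries_unique _ _ S1).
assert (E0 : E O = 1).
{ unfold E; rewrite <- (qpow_0 lq); f_equal; unfold nC; simpl; field. }
(* At n = 0 the weight is 1 and the parameters are unshifted, so the sum W_0 S_0 is the left-hand
   side of the claim. *)
unfold accel_weight, weight_at, phi_at, weight; rewrite E0; simpl.
rewrite !Cmult_1_r; field.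
Qed.
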